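(* Let $\theta_1,\theta_2\in(0,\pi/2)$ and let $A\in\mathcal{M}_n$ satisfy $$W(A)\subseteq\{re^{-i\theta} : r>0,\ \theta_1\leq\theta\leq\theta_2\}.$$ Then $$w^2(A)\ \geq\ \frac{\csc^2\gamma_1}{4}\|AA^*+A^*A\|+\frac{\csc^2\gamma_1}{2}\Big|\,\|\Im(A)\|^2-\|\Re(A)\|^2\,\Big|,$$ where $\gamma_1=\max\{\theta_2,\pi/2-\theta_1\}$.
   Context: $\mathcal{M}_n$ is the algebra of $n\times n$ complex matrices and $\|\cdot\|$ is the operator norm on $\mathcal{M}_n$ induced by the Euclidean norm on $\mathbb{C}^n$. For $A\in\mathcal{M}_n$: the numerical range is $W(A)=\{\langle Ax,x\rangle : x\in\mathbb{C}^n,\ \|x\|=1\}$ and the numerical radius is $w(A)=\sup\{|\langle Ax,x\rangle| : x\in\mathbb{C}^n,\ \|x\|=1\}$; $w^2(A)$ means $(w(A))^2$. The Cartesian parts are $\Re(A)=\frac{A+A^*}{2}$ and $\Im(A)=\frac{A-A^*}{2i}$. *)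

(* Defs.v *)
From mathcomp Require Import all_boot all_order all_algebra.
From mathcomp Require Import spectral complex.
From mathcomp Require Import all_classical all_reals all_analysis.

Set Implicit Arguments.
Unset Strict Implicit.
Unset Printing Implicit Defensive.

Import Order.TTheory GRing.Theory Num.Theory.
Import ComplexField.Normc.

Local Open Scope classical_set_scope.
Local Open Scope ring_scope.
Local Open Scope sesquilinear_scope.
Local Open Scope complex_scope.

Section NumericalRadius.
Context {R : realType}.

(* [dotmx] is the library's Hermitian product of row vectors; this is
   <x, y> = \sum_i x_i (y_i)^*, linear in the first argument. *)
Definition inner n (x y : 'cV[R[i]]_n) : R[i] := dotmx x^T y^T.

Definition vnorm n (x : 'cV[R[i]]_n) : R := Num.sqrt (complex.Re (inner x x)).

(* The supremum is taken over an empty set when n = 0. *)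
Definition opnorm n (A : 'M[R[i]]_n) : R :=
  sup [set vnorm (A *m x) | x in [set x : 'cV[R[i]]_n | vnorm x = 1]].

Definition numerical_range n (A : 'M[R[i]]_n) : set R[i] :=
  [set inner (A *m x) x | x in [set x : 'cV[R[i]]_n | vnorm x = 1]].

Definition numerical_radius n (A : 'M[R[i]]_n) : R :=
  sup [set normc (inner (A *m x) x) | x in [set x : 'cV[R[i]]_n | vnorm x = 1]].

Definition Re_mx n (A : 'M[R[i]]_n) : 'M[R[i]]_n := 2^-1 *: (A + A ^t*).

Definition Im_mx n (A : 'M[R[i]]_n) : 'M[R[i]]_n :=
  (2 * 'i%C)^-1 *: (A - A ^t*).

(* exp (i t) *)
Definition expi (t : R) : R[i] := cos t +i* sin t.

Definition csc (t : R) : R := (sin t)^-1.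

End NumericalRadius.

(* Main.v *)
(* Write [P], [Q] for the real and imaginary parts of [A] and [w] for its
   numerical radius.  A point [r * exp (- i t)] of [W(A)] has [r <= w], and the
   sector condition bounds [cos t] and [sin t] by [sin gamma1]; hence the
   quadratic forms of [P] and [Q] are at most [w * sin gamma1] on the unit
   sphere.  The norm of a Hermitian matrix is at most the supremum of its
   quadratic form, so [a = ||P||] and [b = ||Q||] are at most [w * sin gamma1].
   Finally [A A^* + A^* A = 2 (P^2 + Q^2)] is Hermitian with form
   [2 (||P x||^2 + ||Q x||^2) <= 2 (a^2 + b^2)], and
   [(a^2 + b^2 + |b^2 - a^2|) / 2 = max (a^2, b^2)]. *)
Require Import Defs.
From mathcomp Require Import all_boot all_order all_algebra.
From mathcomp Require Import spectral complex.
From mathcomp Require Import all_classical all_reals all_analysis.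
From mathcomp Require Import ring lra.

Import Order.TTheory GRing.Theory Num.Theory.

Local Open Scope classical_set_scope.
Local Open Scope ring_scope.
Local Open Scope sesquilinear_scope.
Local Open Scope complex_scope.

(** At [t = 1 / c], after multiplication by [c], the hypothesis reads [4 N^2 <= 2 c^2 + 2 N^2]. For
    [c = 0] the value [t = 1] already forces [N = 0]. *)
Lemma le_of_quadratic (R : realFieldType) (c N : R) : 0 <= c -> 0 <= N ->
  (forall t, 4 * t * N ^+ 2 <= 2 * c * (1 + t ^+ 2 * N ^+ 2)) -> N <= c.
Proof.
rewrite le_eqVlt => /orP[/eqP <-|c0] N0 h.
  by have := h 1; nra.
have h1 : 4 * c^-1 * N ^+ 2 * c <= 2 * c * (1 + c^-1 ^+ 2 * N ^+ 2) * c.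
  by rewrite ler_pM2r.
have e1 : 4 * c^-1 * N ^+ 2 * c = 4 * N ^+ 2 by field; rewrite gt_eqF.
have e2 : 2 * c * (1 + c^-1 ^+ 2 * N ^+ 2) * c = 2 * c ^+ 2 + 2 * N ^+ 2.
  by field; rewrite gt_eqF.
rewrite {}e1 {}e2 in h1; rewrite -(ler_pXn2r (ltn0Sn 1)) ?nnegrE // ?(ltW c0) //; lra.
Qed.

(** * Hermitian product, its real part, and norms of Hermitian matrices *)

Section InnerProduct.
Context {R : realType} {n : nat}.
Implicit Types (x y z : 'cV[R[i]]_n) (A B : 'M[R[i]]_n) (a : R[i]).

Lemma innerDl x y z : inner (x + y) z = inner x z + inner y z.
Proof. by rewrite /inner linearD /= linearDl. Qed.

Lemma innerDr x y z : inner x (y + z) = inner x y + inner x z.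
Proof. by rewrite /inner linearD /= linearDr. Qed.

Lemma innerZl a x y : inner (a *: x) y = a * inner x y.
Proof. by rewrite /inner linearZ /= linearZl_LR. Qed.

Lemma innerZr a x y : inner x (a *: y) = Num.conj a * inner x y.
Proof. by rewrite /inner linearZ /= linearZr_LR. Qed.

Lemma inner_conj x y : inner y x = Num.conj (inner x y).
Proof. by rewrite /inner (hermC (@dotmx _ n)) expr0 mul1r. Qed.

Lemma inner_adj A x y : inner (A *m x) y = inner x (A ^t* *m y).
Proof.
by rewrite /inner !dotmxE !trmxK trmx_mul map_mxM map_mxCK mulmxA.
Qed.

Lemma inner_ge0 x : 0 <= inner x x.
Proof. exact: (dnorm_ge0 (@dotmx _ n)). Qed.

Lemma inner_gt0 x : (0 < inner x x) = (x != 0).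
Proof. by rewrite /inner (dnorm_gt0 (@dotmx _ n)) trmx_eq0. Qed.

Lemma inner_self x : inner x x = (vnorm x ^+ 2)%:C.
Proof.
have x0 := inner_ge0 x; rewrite sqr_sqrtr.
  by rewrite RRe_real // ger0_real.
by move: x0; rewrite lecE => /andP[].
Qed.

Lemma vnorm_ge0 x : 0 <= vnorm x.
Proof. exact: sqrtr_ge0. Qed.

Lemma vnorm_gt0 x : (0 < vnorm x) = (x != 0).
Proof.
rewrite -inner_gt0 inner_self ltcR exprn_even_gt0 //=.
by rewrite lt_neqAle eq_sym vnorm_ge0 andbT.
Qed.

(** A symmetric bilinear form over [R], so that estimates take place in an ordered field. *)
Definition re_inner x y : R := complex.Re (inner x y).

Lemma re_innerDl x y z : re_inner (x + y) z = re_inner x z + re_inner y z.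
Proof. by rewrite /re_inner innerDl; case: (inner x z) (inner y z) => ? ? []. Qed.

Lemma re_innerDr x y z : re_inner x (y + z) = re_inner x y + re_inner x z.
Proof. by rewrite /re_inner innerDr; case: (inner x y) (inner x z) => ? ? []. Qed.

Lemma re_innerZl (t : R) x y : re_inner (t%:C *: x) y = t * re_inner x y.
Proof. by rewrite /re_inner innerZl; case: (inner x y) => ? ? /=; ring. Qed.

Lemma re_innerC x y : re_inner x y = re_inner y x.
Proof. by rewrite /re_inner inner_conj; case: (inner y x). Qed.

Lemma re_innerZr (t : R) x y : re_inner x (t%:C *: y) = t * re_inner x y.
Proof. by rewrite re_innerC re_innerZl re_innerC. Qed.

Lemma re_inner_self x : re_inner x x = vnorm x ^+ 2.
Proof. by rewrite /re_inner inner_self. Qed.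

Lemma vnormZ (t : R) x : 0 <= t -> vnorm (t%:C *: x) = t * vnorm x.
Proof.
move=> t0; apply/eqP; rewrite -(eqrXn2 (ltn0Sn 1)) ?mulr_ge0 ?vnorm_ge0 //.
by rewrite -re_inner_self re_innerZl re_innerZr re_inner_self exprMn expr2 mulrA.
Qed.

(* Polarization: for real [t],
   [4 t ||H x||^2 = <H u, u> - <H v, v> <= c (||u||^2 + ||v||^2)] with
   [u = x + t H x], [v = x - t H x]; the choice [t = 1 / c] is optimal. *)
Lemma vnorm_herm_le (H : 'M[R[i]]_n) (c : R) : 0 <= c -> H ^t* = H ->
  (forall x, vnorm x = 1 -> `|re_inner (H *m x) x| <= c) ->
  forall x, vnorm x = 1 -> vnorm (H *m x) <= c.
Proof.
move=> c0 hH hc x x1.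
(* Homogeneity of degree two carries the bound from the unit sphere to every vector; [y = 0] cannot
   be normalized and is treated apart. *)
have hcZ y : `|re_inner (H *m y) y| <= c * re_inner y y.
  rewrite re_inner_self.
  have [->|y0] := eqVneq y 0.
    rewrite mulmx0 /re_inner /inner linear0 linear0l normr0.
    by rewrite mulr_ge0 ?sqr_ge0.
  have ny : 0 < vnorm y by rewrite vnorm_gt0.
  have := hc ((vnorm y)^-1%:C *: y).
  rewrite vnormZ ?invr_ge0 ?vnorm_ge0 // mulVf ?gt_eqF // => /(_ erefl).
  rewrite -scalemxAr re_innerZl re_innerZr mulrA normrM -expr2 exprVn.
  rewrite ger0_norm ?invr_ge0 ?sqr_ge0 // mulrC ler_pdivrMr //.
  by rewrite exprn_gt0.
move Ey : (H *m x) => y.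
have N0 := vnorm_ge0 y; have yy := re_inner_self y; move: (vnorm y) N0 yy => N N0 yy.
(* Self-adjointness moves [H] across: [<H y, x> = <y, H x> = <y, y>]. Both cross terms in the
   expansion along [x + s y] are therefore [s N^2]. *)
have Hyx : re_inner (H *m y) x = N ^+ 2.
  by rewrite /re_inner inner_adj hH Ey -/(re_inner y y) yy.
have line s : `|re_inner y x + 2 * s * N ^+ 2 + s ^+ 2 * re_inner (H *m y) y|
    <= c * (1 + 2 * s * re_inner y x + s ^+ 2 * N ^+ 2).
  have := hcZ (x + s%:C *: y).
  rewrite mulmxDr Ey -(scalemxAr s%:C H y).
  rewrite !(re_innerDl, re_innerDr, re_innerZl, re_innerZr).
  rewrite (re_innerC x y) (re_inner_self x) x1 yy Hyx.
  move: (re_inner y x) (re_inner (H *m y) y) => p q.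
  by congr (`|_| <= _); ring.
move: (re_inner y x) (re_inner (H *m y) y) line => p q line.
have polar t : 4 * t * N ^+ 2 <= 2 * c * (1 + t ^+ 2 * N ^+ 2).
  (* The upper bound at [t] and the lower bound at [- t] are combined: [p] and [q] cancel on the
     left, [2 s p] on the right. *)
  have := line t; have := line (- t).
  rewrite !ler_norml sqrrN => /andP[+ _] /andP[_ +].
  clear; lra.
exact: le_of_quadratic polar.
Qed.

(** * Cartesian decomposition *)

Lemma re_mx_herm A : (Re_mx A) ^t* = Re_mx A.
Proof.
apply/matrixP => i j; rewrite !mxE rmorphM rmorphD fmorphV rmorph_nat /=.
by rewrite conjCK addrC.
Qed.

Lemma im_mx_herm A : (Im_mx A) ^t* = Im_mx A.
Proof.
apply/matrixP => i j; rewrite !mxE complexiE rmorphM rmorphB fmorphV rmorphM.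
rewrite rmorph_nat /= conjCK conjCi.
by rewrite mulrN invrN mulNr -mulrN opprB.
Qed.

Lemma re_inner_re_mx A x : re_inner (Re_mx A *m x) x = complex.Re (inner (A *m x) x).
Proof.
have -> : Re_mx A = (2^-1)%:C *: (A + A ^t*).
  by rewrite /Re_mx rmorphV ?unitfE ?pnatr_eq0 // rmorph_nat.
rewrite -scalemxAl re_innerZl mulmxDl re_innerDl.
have -> : re_inner (A ^t* *m x) x = re_inner (A *m x) x.
  by rewrite re_innerC /re_inner inner_adj.
by rewrite -/(re_inner (A *m x) x); move: (re_inner _ _) => r; field.
Qed.

(** The form of the adjoint is the conjugate of [z = <A x, x>], and [z - conj z = 2 i Im z]. *)
Lemma re_inner_im_mx A x : re_inner (Im_mx A *m x) x = complex.Im (inner (A *m x) x).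
Proof.
rewrite /re_inner /Im_mx -scalemxAl innerZl mulmxBl -scaleN1r innerDl innerZl.
rewrite [inner (A ^t* *m x) x]inner_adj trmxCK (inner_conj (A *m x)).
set z := inner _ _.
have -> : z + - 1 * Num.conj z = 2 * 'i%C * (complex.Im z)%:C.
  by rewrite mulN1r; case: z => a b /=; simpc; congr Complex; ring.
by rewrite mulKf // mulf_neq0 ?pnatr_eq0 // complexiE neq0Ci.
Qed.

Lemma cartesian_mx A : A = Re_mx A + 'i%C *: Im_mx A.
Proof.
apply/matrixP => i j; rewrite !mxE.
by field; rewrite complexiE neq0Ci.
Qed.

Lemma cartesian_mx_adj A : A ^t* = Re_mx A - 'i%C *: Im_mx A.
Proof.
apply/matrixP => i j; rewrite !mxE.
by field; rewrite complexiE neq0Ci.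
Qed.

(** Multiplication by [i] preserves the norm, so this is the parallelogram law for [x] and [i y]. *)
Lemma parallelogram_i x y (u := x + 'i%C *: y) (v := x - 'i%C *: y) :
  re_inner u u + re_inner v v = 2 * (re_inner x x + re_inner y y).
Proof.
have <- : re_inner ('i%C *: y) ('i%C *: y) = re_inner y y.
  rewrite /re_inner innerZl innerZr complexiE conjCi.
  by rewrite mulrA mulrN -expr2 sqrCi opprK mul1r.
rewrite {}/u {}/v; move: ('i%C *: y) => z.
have -> : x - z = x + (-1)%:C *: z by rewrite rmorphN1 scaleN1r.
rewrite !(re_innerDl, re_innerDr) !re_innerZl !re_innerZr.
move: (re_inner x x) (re_inner x z) (re_inner z x) (re_inner z z).
by move=> *; ring.
Qed.

(** The left side is [||A^* x||^2 + ||A x||^2], and these two vectors are [P x - i Q x] and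
    [P x + i Q x] for the Cartesian parts [P], [Q]. *)
Lemma re_inner_mul_adj_add A x :
  re_inner ((A *m A ^t* + A ^t* *m A) *m x) x =
  2 * (re_inner (Re_mx A *m x) (Re_mx A *m x) +
       re_inner (Im_mx A *m x) (Im_mx A *m x)).
Proof.
rewrite -parallelogram_i (scalemxAl 'i%C (Im_mx A) x) -mulmxDl -mulmxBl.
rewrite -cartesian_mx_adj -cartesian_mx mulmxDl -!mulmxA re_innerDl addrC.
by rewrite /re_inner !inner_adj trmxCK.
Qed.

(** * Boundedness of the sets whose suprema are taken *)

Lemma innerE x y : inner x y = \sum_i x i 0 * Num.conj (y i 0).
Proof. by rewrite /inner dotmxE !mxE; apply: eq_bigr => i _; rewrite !mxE. Qed.

Lemma unit_coord_le1 x i : vnorm x = 1 -> `|x i 0| <= 1.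
Proof.
move=> x1; have := inner_self x; rewrite x1 expr1n innerE (bigD1 i) //= => s1.
rewrite -(@expr_le1 _ 2) ?normr_ge0 // normCK.
have -> : (1 : R[i]) = 1%:C by [].
rewrite -s1 lerDl sumr_ge0 // => j _.
by rewrite -normCK exprn_ge0.
Qed.

Lemma numerical_radius_ub A x : vnorm x = 1 ->
  ComplexField.Normc.normc (inner (A *m x) x) <= numerical_radius A.
Proof.
move=> x1; apply: ub_le_sup; last by exists x.
(* Coordinates of a unit vector have modulus at most 1, so the sum of the moduli of the entries
   bounds the form. Moduli here are elements of [R[i]], hence the real part. *)
exists (complex.Re (\sum_i \sum_j `|A i j|)) => _ [y y1 <-].
have : `|inner (A *m y) y| <= \sum_i \sum_j `|A i j|; last first.
  by rewrite lecE => /andP[_].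
rewrite innerE (le_trans (ler_norm_sum _ _ _)) // ler_sum // => i _.
rewrite mxE mulr_suml (le_trans (ler_norm_sum _ _ _)) // ler_sum // => j _.
rewrite !normrM -mulrA ler_piMr // mulr_ile1 // ?norm_conjC unit_coord_le1 //.
Qed.

Lemma opnorm_le A c : (exists x : 'cV[R[i]]_n, vnorm x = 1) ->
  (forall x, vnorm x = 1 -> vnorm (A *m x) <= c) -> opnorm A <= c.
Proof.
move=> [x x1] hc; apply: ge_sup; first by exists (vnorm (A *m x)), x.
by move=> _ [y y1 <-]; exact: hc.
Qed.

(** The uniform bound [c] makes the set bounded above, so that [sup] is a genuine least upper
    bound. *)
Lemma opnorm_ub A c x : (forall y, vnorm y = 1 -> vnorm (A *m y) <= c) ->
  vnorm x = 1 -> vnorm (A *m x) <= opnorm A.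
Proof.
move=> hc x1; apply: ub_le_sup; last by exists x.
by exists c => _ [y y1 <-]; exact: hc.
Qed.

End InnerProduct.

(** * Unit vectors, the sector, and the final estimate *)

Lemma unit_vector_exists (R : realType) (n : nat) : (0 < n)%N ->
  exists x : 'cV[R[i]]_n, vnorm x = 1.
Proof.
case: n => // n _; exists (delta_mx 0 0).
rewrite /vnorm innerE (bigD1 0) //= big1 => [|j j0].
  rewrite !mxE !eqxx andTb mul1r addr0 rmorph1.
  exact: sqrtr1.
by rewrite !mxE (negbTE j0) mul0r.
Qed.

(** Since [cos theta = sin (pi / 2 - theta)], and both [theta] and [pi / 2 - theta] lie between 0
    and [g < pi / 2], where the sine increases, [sin g] dominates both. *)
Lemma sector_bounds (R : realType) (theta1 theta2 theta : R) :
  0 < theta1 < pi / 2 -> 0 < theta2 < pi / 2 ->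
  theta1 <= theta <= theta2 ->
  let g := Num.max theta2 (pi / 2 - theta1) in
  [/\ 0 < sin g, `|cos theta| <= sin g & `|sin theta| <= sin g].
Proof.
move=> /andP[h1 h1'] /andP[h2 h2'] /andP[t1 t2] g.
have [g2 g1] : theta2 <= g /\ pi / 2 - theta1 <= g.
  by rewrite !le_max !lexx orbT.
have gpi : g < pi / 2 by rewrite gt_max h2' /=; lra.
have sinle (a : R) : 0 <= a -> a <= g -> sin a <= sin g.
  move=> a0 ag; rewrite leNgt ltr_sin ?in_itv /= -?leNgt //; apply/andP; split; lra.
split.
- by apply: sin_gt0_pihalf; apply/andP; split; lra.
- rewrite ger0_norm; last by apply: cos_ge0_pihalf; apply/andP; split; lra.
  by rewrite -cosN -sinDpihalf sinle //; lra.
- rewrite ger0_norm; first by apply: sinle; lra.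
  by apply: sin_ge0_pi; apply/andP; split; lra.
Qed.

Theorem theorem3p7 (R : realType) (n : nat) (n_gt0 : (0 < n)%N)
    (theta1 theta2 : R) (A : 'M[R[i]]_n)
    (htheta1 : 0 < theta1 < pi / 2) (htheta2 : 0 < theta2 < pi / 2)
    (hW : numerical_range A `<=`
      [set z | exists r theta : R,
        [/\ 0 < r, theta1 <= theta <= theta2 & z = r%:C * expi (- theta)]]) :
  let gamma1 := Num.max theta2 (pi / 2 - theta1) in
  numerical_radius A ^+ 2 >=
    csc gamma1 ^+ 2 / 4 * opnorm (A *m A ^t* + A ^t* *m A) +
    csc gamma1 ^+ 2 / 2 * `| opnorm (Im_mx A) ^+ 2 - opnorm (Re_mx A) ^+ 2 |.
Proof.
cbv zeta; set g := Num.max theta2 _; set w := numerical_radius A.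
have [x0 x01] := unit_vector_exists R n n_gt0.
have sphere : exists x : 'cV[R[i]]_n, vnorm x = 1 by exists x0.
pose s := sin g.
have bounds x : vnorm x = 1 ->
    [/\ 0 < s, `|re_inner (Re_mx A *m x) x| <= w * s &
        `|re_inner (Im_mx A *m x) x| <= w * s].
  move=> x1.
  have [|r [t [r0 ht zE]]] := hW (inner (A *m x) x); first by exists x.
  have [s0 cs ss] := sector_bounds _ _ _ _ htheta1 htheta2 ht.
  (* [expi (- t)] has modulus 1, so [r] is the modulus of [<A x, x>]. *)
  have rw : r <= w.
    apply: le_trans (numerical_radius_ub A x x1); rewrite zE ComplexField.Normc.normcM /=.
    by rewrite cosN sinN sqrrN cos2Dsin2 sqrtr1 mulr1 expr0n addr0 sqrtr_sqr ler_norm.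
  split=> //.
  - rewrite re_inner_re_mx zE /= cosN mul0r subr0 normrM (gtr0_norm r0).
    by apply: ler_pM => //; exact: ltW.
  - rewrite re_inner_im_mx zE /= sinN mul0r addr0 mulrN normrN normrM (gtr0_norm r0).
    by apply: ler_pM => //; exact: ltW.
have [s0 Px0 _] := bounds x0 x01.
have c0 : 0 <= w * s := le_trans (normr_ge0 _) Px0.
(* The Cartesian parts become opaque: only their symmetry, their form bounds and the identity for
   [A A^* + A^* A] matter from here on. *)
have := re_inner_mul_adj_add A; have := im_mx_herm A; have := re_mx_herm A.
move: (Re_mx A) (Im_mx A) bounds {Px0} => P Q bounds hP hQ hM.
have P_le x : vnorm x = 1 -> vnorm (P *m x) <= w * s.
  by apply: vnorm_herm_le hP _ _ => // y /bounds[].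
have Q_le x : vnorm x = 1 -> vnorm (Q *m x) <= w * s.
  by apply: vnorm_herm_le hQ _ _ => // y /bounds[].
have a_le := opnorm_le _ _ sphere P_le; have b_le := opnorm_le _ _ sphere Q_le.
have P_a x := opnorm_ub _ _ x P_le; have Q_b x := opnorm_ub _ _ x Q_le.
move: (opnorm P) (opnorm Q) a_le b_le P_a Q_b => a b a_le b_le P_a Q_b.
have a0 : 0 <= a := le_trans (vnorm_ge0 _) (P_a x0 x01).
have b0 : 0 <= b := le_trans (vnorm_ge0 _) (Q_b x0 x01).
have M_le : opnorm (A *m A ^t* + A ^t* *m A) <= 2 * (a ^+ 2 + b ^+ 2).
  apply: opnorm_le => //; apply: vnorm_herm_le.
  - by rewrite mulr_ge0 ?addr_ge0 ?sqr_ge0.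
  - rewrite linearD map_mxD /= !trmx_mul !map_mxM.
    by rewrite -!map_trmx !trmxK map_mxCK.
  move=> x x1; rewrite hM !re_inner_self.
  rewrite ger0_norm ?mulr_ge0 ?addr_ge0 ?sqr_ge0 //.
  rewrite ler_pM2l ?ltr0n //; apply: lerD.
  - by rewrite ler_pXn2r ?nnegrE ?vnorm_ge0 ?P_a.
  - by rewrite ler_pXn2r ?nnegrE ?vnorm_ge0 ?Q_b.
rewrite /csc exprVn -/s.
have s2 : 0 < s ^+ 2 by rewrite exprn_gt0.
(* Multiplying by [s^2] clears the cosecants and leaves [M / 4 + |b^2 - a^2| / 2 <= (w s)^2]. *)
rewrite -(ler_pM2r s2).
set M := opnorm (_ + _) in M_le *.
have -> : ((s ^+ 2)^-1 / 4 * M + (s ^+ 2)^-1 / 2 * `|b ^+ 2 - a ^+ 2|) * s ^+ 2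
    = M / 4 + `|b ^+ 2 - a ^+ 2| / 2 by field; rewrite gt_eqF.
rewrite -exprMn.
have a2 : a ^+ 2 <= (w * s) ^+ 2 by rewrite ler_pXn2r ?nnegrE.
have b2 : b ^+ 2 <= (w * s) ^+ 2 by rewrite ler_pXn2r ?nnegrE.
move: (a ^+ 2) (b ^+ 2) ((w * s) ^+ 2) M M_le a2 b2 => p q c M.
(* The comparison of [p] with [q] also resolves the absolute value, and [M / 4 <= (p + q) / 2] makes
   the goal linear. *)
by clear; case: (lerP p q) => ? ? ? ?; lra.
Qed.
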